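(* Every end space is a $D$-space; that is, for every graph $G$, the end space $\Omega(G)$ is a $D$-space.
   Context: A graph is a pair $G=(V(G),E(G))$ with $V(G)$ an arbitrary set and $E(G)\subseteq [V(G)]^2$ (two-element subsets). A ray in $G$ is an injective sequence of vertices $(v_0,v_1,\dots)$ with $\{v_i,v_{i+1}\}\in E(G)$ for all $i$; a tail of it is $(v_n,v_{n+1},\dots)$ for some $n$. For finite $F\subseteq V(G)$, $G\setminus F$ is the subgraph induced on $V(G)\setminus F$; a connected component is a maximal connected subgraph. Two rays of $G$ are equivalent if for every finite $F\subseteq V(G)$ they have tails lying in the same connected component of $G\setminus F$. An end is an equivalence class of rays, and $\Omega(G)$ is the set of ends. For an end $\epsilon$ and finite $F\subseteq V(G)$, $G(\epsilon,F)$ is the unique connected component of $G\setminus F$ containing a tail of every ray of $\epsilon$, and $\Omega(\epsilon,F)$ is the set of all ends having a ray contained in $G(\epsilon,F)$. A set $U\subseteq\Omega(G)$ is open if for every $\epsilon\in U$ there is a finite $F\subseteq V(G)$ with $\Omega(\epsilon,F)\subseteq U$; this topologizes $\Omega(G)$, the end space of $G$. A topological space $X$ is a $D$-space if for every open neighborhood assignment $(U_x:x\in X)$ (i.e. each $U_x$ is an open set containing $x$) there is a closed discrete set $D\subseteq X$ with $\bigcup_{x\in D}U_x=X$. *)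

(* Defs.v *)
From HB Require Import structures.
From Stdlib Require Import Relation_Operators.
From mathcomp Require Import all_boot.
From mathcomp Require Import all_classical topology.

Set Implicit Arguments.
Unset Strict Implicit.
Unset Printing Implicit Defensive.

Local Open Scope classical_set_scope.

(* The vertices of a graph form an arbitrary set of elements of an ambient
   type T, so that subgraphs of a graph over T are again graphs over T. *)
Record graph (T : Type) := Graph {
  vertices : set T;
  edges : set (set T);
  edges_pairs :
    edges `<=` [set e | e `<=` vertices /\ (e #= `I_2)%card] }.

HB.instance Definition _ (T : Type) := gen_eqMixin (graph T).
HB.instance Definition _ (T : Type) := gen_choiceMixin (graph T).

Section graphs.
Context {T : Type}.
Implicit Types (G H C : graph T) (F : set T) (r s : nat -> T).

Definition adj G (x y : T) : Prop := edges G [set x; y].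

Definition subgraph H G : Prop :=
  vertices H `<=` vertices G /\ edges H `<=` edges G.

Lemma graph_minus_pairs G F :
  [set e | edges G e /\ e `<=` vertices G `\` F] `<=`
  [set e | e `<=` vertices G `\` F /\ (e #= `I_2)%card].
Proof. by move=> e [/edges_pairs[_ e2] eGF]; split. Qed.

(* the subgraph of G induced on its vertices outside F *)
Definition graph_minus G F : graph T := Graph (@graph_minus_pairs G F).

Definition connected_graph G : Prop :=
  vertices G !=set0 /\
  forall x y, vertices G x -> vertices G y -> clos_refl_trans T (adj G) x y.

(* maximal connected subgraphs *)
Definition component G C : Prop :=
  [/\ subgraph C G, connected_graph C &
    forall H, subgraph H G -> connected_graph H -> subgraph C H ->
      subgraph H C].

Definition ray G r : Prop :=
  [/\ forall i, vertices G (r i), injective r & forall i, adj G (r i) (r i.+1)].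

Definition tail (n : nat) r : nat -> T := fun i => r (n + i)%N.

Definition ray_equiv G r s : Prop :=
  forall F, finite_set F -> F `<=` vertices G ->
    exists C, [/\ component (graph_minus G F) C,
      exists m, ray C (tail m r) & exists n, ray C (tail n s)].

Definition ends G : set (set (nat -> T)) :=
  [set e | exists2 r, ray G r & e = [set s | ray G s /\ ray_equiv G r s]].

End graphs.

Definition end_space (T : Type) (G : graph T) : Type :=
  {e : set (nat -> T) | e \in ends G}.

HB.instance Definition _ (T : Type) (G : graph T) := gen_eqMixin (end_space G).
HB.instance Definition _ (T : Type) (G : graph T) :=
  gen_choiceMixin (end_space G).

Section end_components.
Context {T : Type}.
Implicit Types (G H C D : graph T) (F : set T) (r s : nat -> T).

Definition is_end_component G (e : end_space G) F C : Prop :=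
  component (graph_minus G F) C /\
  forall s, val e s -> exists n, ray C (tail n s).

(* The default value G is only reached for infinite F: see
   [end_componentP] and [end_component_unique]. *)
Definition end_component G (e : end_space G) F : graph T :=
  xget G [set C | is_end_component e F C].

Definition ends_in G (e : end_space G) F : set (end_space G) :=
  [set f | exists2 r, val f r & ray (end_component e F) r].

Definition end_open G (U : set (end_space G)) : Prop :=
  forall e, U e -> exists F,
    [/\ finite_set F, F `<=` vertices G & ends_in e F `<=` U].

Lemma graph_eq G H : vertices G = vertices H -> edges G = edges H -> G = H.
Proof.
case: G H => [V E p] [V' E' p'] /= VV EE; subst.
by congr Graph; exact: Prop_irrelevance.
Qed.

Lemma subgraph_refl G : subgraph G G.
Proof. by split. Qed.

Lemma subgraph_trans G H C : subgraph G H -> subgraph H C -> subgraph G C.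
Proof.
by move=> [v e] [v' e']; split; [exact: subset_trans v'|exact: subset_trans e'].
Qed.

Lemma subgraph_anti G H : subgraph G H -> subgraph H G -> G = H.
Proof. by move=> [v e] [v' e']; apply: graph_eq; apply/seteqP; split. Qed.

Lemma ray_subgraph C G r : subgraph C G -> ray C r -> ray G r.
Proof.
move=> [v e] [vr ir er]; split=> // i; first exact: v.
exact/e/er.
Qed.

Lemma ray_tail G r n : ray G r -> ray G (tail n r).
Proof.
move=> [vr ir er]; split=> [i|i j /ir/addnI//|i]; rewrite /tail //.
by rewrite addnS; exact: er.
Qed.

Lemma tail_tail m n r : tail m (tail n r) = tail (n + m) r.
Proof. by apply/funext => i; rewrite /tail addnA. Qed.

Lemma adjC G x y : adj G x y -> adj G y x.
Proof. by rewrite /adj setUC. Qed.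

Lemma clos_adj_sym G x y :
  clos_refl_trans T (adj G) x y -> clos_refl_trans T (adj G) y x.
Proof.
elim=> [u v /adjC|u|u v w _ vu _ wv]; first exact: rt_step.
- exact: rt_refl.
- exact: rt_trans wv vu.
Qed.

Lemma clos_adj_sub G H x y : subgraph G H ->
  clos_refl_trans T (adj G) x y -> clos_refl_trans T (adj H) x y.
Proof.
move=> [_ GH]; elim=> [u v /GH|u|u v w _ uv _ vw]; first exact: rt_step.
- exact: rt_refl.
- exact: rt_trans uv vw.
Qed.

Definition union_edges (P : set (graph T)) := \bigcup_(C in P) edges C.

Lemma union_pairs (P : set (graph T)) :
  union_edges P `<=`
  [set e | e `<=` \bigcup_(C in P) vertices C /\ (e #= `I_2)%card].
Proof.
move=> e [C PC /edges_pairs[eC e2]]; split=> // x /eC xC.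
by exists C.
Qed.

Definition graph_union (P : set (graph T)) := Graph (@union_pairs P).

Definition around H x : set (graph T) :=
  [set C | [/\ subgraph C H, connected_graph C & vertices C x]].

Lemma component_around H C x : component H C -> vertices C x ->
  C = graph_union (around H x).
Proof.
move=> [CH cC maxC] Cx.
have aC : around H x C by [].
have CU : subgraph C (graph_union (around H x)).
  by split=> [y Cy|e Ce]; exists C.
apply: subgraph_anti => //; apply: maxC => //.
  by split=> [y [D [[DH _] _ _] /DH]|e [D [[_ DH] _ _] /DH]].
split; first by exists x; exists C.
have xto y : vertices (graph_union (around H x)) y ->
    clos_refl_trans T (adj (graph_union (around H x))) x y.
  move=> [D aD Dy]; have [_ [_ cD] Dx] := aD.
  apply: (@clos_adj_sub D); last exact: cD.
  by split=> [z Dz|e De]; exists D.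
move=> y z /xto xy /xto xz.
exact: rt_trans (clos_adj_sym xy) xz.
Qed.

Lemma component_exists H D x : subgraph D H -> connected_graph D ->
  vertices D x -> exists2 C, component H C & subgraph D C.
Proof.
move=> DH cD Dx; have aD : around H x D by [].
exists (graph_union (around H x)); last by split=> [y Dy|e De]; exists D.
split.
- by split=> [y [C [[CH _] _ _] /CH]|e [C [[_ CH] _ _] /CH]].
- split; first by exists x; exists D.
  have xto y : vertices (graph_union (around H x)) y ->
      clos_refl_trans T (adj (graph_union (around H x))) x y.
    move=> [C aC Cy]; have [_ [_ cC] Cx] := aC.
    apply: (@clos_adj_sub C); last exact: cC.
    by split=> [z Cz|e Ce]; exists C.
  move=> y z /xto xy /xto xz.
  exact: rt_trans (clos_adj_sym xy) xz.
- move=> C CH cC UC.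
  have aC : around H x C by split=> //; apply UC.1; exists D.
  by split=> [y Cy|e Ce]; exists C.
Qed.

Lemma component_unique H C D x : component H C -> component H D ->
  vertices C x -> vertices D x -> C = D.
Proof.
by move=> hC hD Cx Dx; rewrite (component_around hC Cx) (component_around hD Dx).
Qed.

Lemma ray_component H r : ray H r -> exists2 C, component H C & ray C r.
Proof.
move=> [vr ir er].
have pairs : [set e | exists i, e = [set r i; r i.+1]] `<=`
    [set e | e `<=` range r /\ (e #= `I_2)%card].
  move=> e [i ->]; have [_ e2] := edges_pairs (er i).
  by split=> // x [->|->]; [exists i|exists i.+1].
pose D := Graph pairs.
have DH : subgraph D H.
  by split=> [_ [i _ <-]|e [i ->]]; [exact: vr|exact: er].
have from0 i : clos_refl_trans T (adj D) (r 0%N) (r i).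
  elim: i => [|i IH]; first exact: rt_refl.
  by apply: rt_trans IH _; apply: rt_step; exists i.
have cD : connected_graph D.
  split; first by exists (r 0%N); exists 0%N.
  move=> _ _ [i _ <-] [j _ <-].
  exact: rt_trans (clos_adj_sym (from0 i)) (from0 j).
have [|C hC DC] := component_exists DH cD (x := r 0%N); first by exists 0%N.
exists C => //; apply: ray_subgraph DC _; split=> // i; first by exists i.
by exists i.
Qed.

Lemma ray_minus G r F : ray G r -> finite_set F ->
  exists n, ray (graph_minus G F) (tail n r).
Proof.
move=> rG finF; have [vr ir er] := rG.
have /finite_seqP[l rFl] : finite_set (r @^-1` F).
  by apply: finite_preimage finF => i j _ _; exact: ir.
exists (\max_(i <- l) i).+1.
have outF i : (vertices G `\` F) (tail (\max_(i <- l) i).+1 r i).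
  split=> [|Fi]; first exact: vr.
  have : (r @^-1` F) ((\max_(i <- l) i).+1 + i)%N by [].
  rewrite rFl /= => il.
  have := @leq_bigmax_seq _ l xpredT id _ il isT.
  by rewrite leqNgt addSn ltnS leq_addr.
have [_ itr etr] := ray_tail (\max_(i <- l) i).+1 rG.
split=> // i; split; first exact: etr.
by move=> x [->|->]; exact: outF.
Qed.

Lemma ray_equiv_refl G r : ray G r -> ray_equiv G r r.
Proof.
move=> rG F finF _; have [n rn] := ray_minus rG finF.
by have [C hC rC] := ray_component rn; exists C; split=> //; exists n.
Qed.

Lemma ray_meet C D r m n : ray C (tail m r) -> ray D (tail n r) ->
  vertices C (r (m + n)%N) /\ vertices D (r (m + n)%N).
Proof.
move=> [rC _ _] [rD _ _]; split; first exact: rC.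
by rewrite addnC; exact: rD.
Qed.

Lemma ray_equiv_sym G r s : ray_equiv G r s -> ray_equiv G s r.
Proof. by move=> rs F finF /(rs F finF)[C [hC rC sC]]; exists C. Qed.

Lemma ray_equiv_trans G r s t :
  ray_equiv G r s -> ray_equiv G s t -> ray_equiv G r t.
Proof.
move=> rs st F finF FG; have [C [hC rC [m sC]]] := rs F finF FG.
have [D [hD [n sD] tD]] := st F finF FG.
have [Cx Dx] := ray_meet sC sD.
by rewrite -(component_unique hC hD Cx Dx) in tD; exists C.
Qed.

Lemma end_componentP G (e : end_space G) F :
  finite_set F -> F `<=` vertices G ->
  is_end_component e F (end_component e F).
Proof.
move=> finF FG; apply: xgetPex; case: e => e /= eG.
have [r rG ee] := set_mem eG.
have [C [hC [m rC] _]] := ray_equiv_refl rG finF FG.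
exists C; split=> //= s; rewrite ee => -[sG /(_ F finF FG)].
move=> [D [hD [k rD] [n sD]]]; exists n.
have [Cx Dx] := ray_meet rC rD.
by rewrite (component_unique hC hD Cx Dx).
Qed.

Lemma end_component_unique G (e : end_space G) F C :
  finite_set F -> F `<=` vertices G ->
  is_end_component e F C -> C = end_component e F.
Proof.
move=> finF FG [hC eC]; have [hD eD] := end_componentP e finF FG.
have [r er] : exists r, val e r.
  case: e {eC eD hD} => e eG /=; have [r rG ->] := set_mem eG.
  by exists r; split=> //; exact: ray_equiv_refl.
have [m rC] := eC r er; have [n rD] := eD r er.
have [Cx Dx] := ray_meet rC rD.
exact: component_unique hC hD Cx Dx.
Qed.

Lemma component_mono H G C D x : component H C -> component G D ->
  subgraph H G -> vertices C x -> vertices D x -> subgraph C D.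
Proof.
move=> [CH cC _] hD HG Cx Dx; rewrite (component_around hD Dx).
have aC : around G x C by split=> //; exact: subgraph_trans HG.
by split=> [y Cy|e Ce]; exists C.
Qed.

Lemma ends_inS G (e : end_space G) F F' : finite_set F' ->
  F' `<=` vertices G -> F `<=` F' -> ends_in e F' `<=` ends_in e F.
Proof.
move=> finF' F'G FF' f [r fr rC]; exists r => //; apply: ray_subgraph rC.
have finF : finite_set F by exact: sub_finite_set finF'.
have FG : F `<=` vertices G by exact: subset_trans F'G.
have [hC eC] := end_componentP e finF' F'G.
have [hD eD] := end_componentP e finF FG.
have [s es] : exists s, val e s.
  case: e {eC eD hD hC fr} => e eG /=; have [s sG ->] := set_mem eG.
  by exists s; split=> //; exact: ray_equiv_refl.
have [m sC] := eC s es; have [n sD] := eD s es.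
have [Cx Dx] := ray_meet sC sD.
apply: component_mono hC hD _ Cx Dx.
have VV : vertices G `\` F' `<=` vertices G `\` F by exact: setDS.
by split=> //= a [Ga aF']; split=> //; exact: subset_trans VV.
Qed.

Lemma end_openT G : end_open [set: end_space G].
Proof. by move=> e _; exists set0; split. Qed.

Lemma end_openI G : setI_closed (@end_open G).
Proof.
move=> U W oU oW e [/oU[F [finF FG FU]] /oW[F' [finF' F'G F'W]]].
have finFF' : finite_set (F `|` F') by rewrite finite_setU.
have FF'G : F `|` F' `<=` vertices G by rewrite subUset.
exists (F `|` F'); split=> // f Ff; split.
- by apply: FU; apply: ends_inS Ff => //; exact: subsetUl.
- by apply: F'W; apply: ends_inS Ff => //; exact: subsetUr.
Qed.

Lemma end_open_bigU G (I : Type) (U : I -> set (end_space G)) :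
  (forall i, end_open (U i)) -> end_open (\bigcup_i U i).
Proof.
move=> oU e [i _ /oU[F [finF FG FU]]]; exists F; split=> // f /FU Uf.
by exists i.
Qed.

End end_components.

HB.instance Definition _ (T : Type) (G : graph T) :=
  isOpenTopological.Build (end_space G)
    (@end_openT T G) (@end_openI T G) (@end_open_bigU T G).

Lemma open_endsE (T : Type) (G : graph T) : @open (end_space G) = @end_open T G.
Proof. by []. Qed.

(* open_nbhs x A means that A is open and contains x *)
Definition D_space (X : topologicalType) : Prop :=
  forall U : X -> set X, (forall x, open_nbhs x (U x)) ->
    exists D : set X,
      [/\ closed D, D `<=` isolated D & \bigcup_(x in D) U x = [set: X]].

(* Main.v *)
Require Import Defs.
From mathcomp Require Import all_boot all_classical topology.

Set Implicit Arguments.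
Unset Strict Implicit.
Unset Printing Implicit Defensive.

Local Open Scope classical_set_scope.

(** Call a finite vertex set [F] good for an end [e] if the basic neighbourhood
    of [e] given by [F] lies in the open set assigned to [e]. It is enough to
    find a set [A] of pairs [(e, F)] with [F] good for [e] whose basic
    neighbourhoods cover all ends and contain only finitely many ends of [A]
    each: finite sets are closed, so the ends of [A] then form a closed discrete
    set.

    Such an [A] is built in omega levels, together with an increasing set [H] of
    vertices, so that at each level
    - every end adherent to [H] is covered by a pair of [A],
    - the finite sets in the pairs of [A] are contained in [H],
    - vertices of [H] joined by a path outside [H] cannot be separated by
      finitely many other vertices.
    The point is that a component [C] of [G - H] containing an uncovered end has
    a finite boundary ([uncovered_boundary]). Otherwise a ray runs through
    infinitely many vertices of the boundary, because these are pairwise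
    inseparable. Its end is adherent to [H], hence covered by some [(e, F)];
    as [F] is contained in [H] it misses [C], and so [C] lies on the same side
    of [F] as that ray: every end of [C] is covered.

    The next level therefore treats all these components separately, and adds to
    [H] a subset of each of them ([local_cover_ex]). Nothing is left after omega
    levels. If an uncovered end is adherent to the union of the sets [H], a good
    set for it has its finite trace on the union inside some [H], and the last
    clause of [local_cover] at that level forbids this ([union_cover]). If it is
    not adherent, the component of the end has a finite boundary, contained
    in some [H]; it is then already a component at that level, and loses a
    vertex to the next one ([union_covers]).

    Inside one component [C] the boundary is finite and countably many steps
    suffice. At each step one is given a region [R] cut off by finitely many of
    the vertices collected so far, and picks, if possible, an uncovered end [e]
    of [R] and a good [F] such that all collected vertices of [R] lie on the
    side of [e]; then [F] is collected. If an uncovered end [e'] were a candidate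
    forever, the sets [F] picked for [R] would be disjoint within [R], and the
    sides of [e'] would decrease to the empty set ([stage_leaves]). One of
    these sides thus avoids any given good set of [e'], so the corresponding
    collected set [F] is itself good for [e']. When the region cut off by [F]
    around [e'] has its turn, the preference given to candidates that cover the
    whole region forces [e'] to be covered ([no_uncovered]). *)

(** * Walks and regions *)

Section ends_of_a_graph.
Context {T : choiceType} (G : graph T).
Implicit Types (X Y Z F H M C : set T) (x y z u v : T) (e f r s : nat -> T).

(** Walks all of whose vertices, including both endpoints, lie in [X]. *)
Inductive linked X x : T -> Prop :=
| linked0 : X x -> linked X x x
| linkedS y z : linked X x y -> adj G y z -> X z -> linked X x z.

Lemma linked_r X x y : linked X x y -> X y.
Proof. by case. Qed.

Lemma linked_l X x y : linked X x y -> X x.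
Proof. by elim. Qed.

Lemma linked_trans X y x z : linked X x y -> linked X y z -> linked X x z.
Proof. by move=> xy; elim=> // u v _ xu uv Xv; exact: linkedS xu uv Xv. Qed.

Lemma linked_edge X x y : X x -> X y -> adj G x y -> linked X x y.
Proof. by move=> Xx Xy xy; exact: linkedS (linked0 Xx) xy Xy. Qed.

Lemma linked_sym X x y : linked X x y -> linked X y x.
Proof.
elim=> [|u v xu ux uv Xv]; first exact: linked0.
exact: linked_trans (linked_edge Xv (linked_r xu) (adjC uv)) ux.
Qed.

Lemma linked_sub X Y x y : X `<=` Y -> linked X x y -> linked Y x y.
Proof.
move=> XY; elim=> [/XY|u v _ xu uv /XY]; first exact: linked0.
exact: linkedS xu uv.
Qed.

Lemma linked_in X x y : linked X x y -> linked (linked X x) x y.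
Proof.
elim=> [Xx|u v xu IH uv Xv]; first exact/linked0/linked0.
exact: linkedS IH uv (linkedS xu uv Xv).
Qed.

Lemma linked_path X x y : linked X x y -> exists p : seq T,
  [/\ path (fun a b => `[<adj G a b>]) x p, last x p = y, uniq (x :: p) &
    forall z, z \in x :: p -> X z].
Proof.
move=> xy.
have [p [px py pX]] : exists p : seq T,
    [/\ path (fun a b => `[<adj G a b>]) x p, last x p = y &
      forall z, z \in x :: p -> X z].
  elim: xy => [Xx|u v _ [p [px pu pX]] uv Xv].
    by exists [::]; split=> // z; rewrite inE => /eqP->.
  exists (rcons p v); split; last 1 first.
  - by move=> z; rewrite -rcons_cons mem_rcons inE => /orP[/eqP->|/pX].
  - by rewrite rcons_path px pu; apply/asboolP.
  - by rewrite last_rcons.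
case/shortenP: px py => q qx quniq qp qy.
exists q; split=> // z; rewrite inE => /orP[/eqP->|/qp zp].
  by apply: pX; rewrite mem_head.
by apply: pX; rewrite inE zp orbT.
Qed.

Lemma linked_exit X Z x y : linked X x y -> Z x -> ~ Z y ->
  exists u v, [/\ linked X x u, Z u, ~ Z v, X v & adj G u v].
Proof.
move=> + Zx; elim=> [//|u v xu IH uv Xv nZv].
have [Zu|/IH//] := pselect (Z u).
by exists u, v; split.
Qed.

Definition connected_set Z := forall x y, Z x -> Z y -> linked Z x y.

(** [region r X] is the component of [G] minus [X] in which the ray [r] has a
    tail, and is empty when [r] has no tail avoiding [X]. For a finite [F], the
    rays with the same region as [r] form the basic neighbourhood of the end of
    [r] given by [F]; rays stand for their ends until the last part. *)
Definition region r X : set T :=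
  [set y | exists2 m, forall k, (m <= k)%N -> ~ X (r k) &
                      linked (~` X) (r m) y].

Lemma ray_linked X r m : ray G r -> (forall k, (m <= k)%N -> X (r k)) ->
  forall k, (m <= k)%N -> linked X (r m) (r k).
Proof.
move=> [_ _ radj] Xr k /subnKC <-; elim: (k - m)%N => [|j IH].
  by rewrite addn0; apply/linked0/Xr.
rewrite addnS; apply: linkedS IH (radj _) _.
by apply: Xr; rewrite -addnS leq_addr.
Qed.

Lemma region_notin r X y : region r X y -> ~ X y.
Proof. by move=> [m _ /linked_r]. Qed.

Lemma region_linked r X y z : region r X y -> linked (~` X) y z -> region r X z.
Proof. by move=> [m mX my] yz; exists m => //; exact: linked_trans yz. Qed.

Lemma region_adj r X y z : region r X y -> adj G y z -> ~ X z -> region r X z.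
Proof.
move=> ry yz Xz; apply: (region_linked ry).
exact: linked_edge (region_notin ry) Xz yz.
Qed.

Lemma region_connected r X : ray G r -> connected_set (region r X).
Proof.
move=> rG.
have half y : region r X y ->
    exists2 m, forall k, (m <= k)%N -> ~ X (r k) &
               linked (region r X) (r m) y.
  move=> [m mX my]; exists m => //; apply: linked_sub (linked_in my).
  by move=> z mz; exists m.
move=> x y /half[m mX mx] /half[n nX ny].
have tail_in k l : (forall k', (k <= k')%N -> ~ X (r k')) -> (k <= l)%N ->
    region r X (r l).
  by move=> kX kl; exists k => //; exact: ray_linked kl.
have to j i : (j <= i)%N -> (forall k, (j <= k)%N -> ~ X (r k)) ->
    linked (region r X) (r j) (r i).
  move=> ji jX; apply: (ray_linked rG) ji => k jk; exact: tail_in jX jk.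
apply: linked_trans (linked_sym mx) _; apply: linked_trans ny.
apply: linked_trans (to _ (maxn m n) (leq_maxl _ _) mX) _.
exact/linked_sym/to/nX/leq_maxr.
Qed.

Lemma region_tail r X y : ray G r -> region r X y ->
  exists m, forall k, (m <= k)%N -> region r X (r k).
Proof.
move=> rG [m mX _]; exists m => k mk; exists m => //.
exact: ray_linked mk.
Qed.

Lemma region_finite r F : ray G r -> finite_set F ->
  exists m, forall k, (m <= k)%N -> region r F (r k).
Proof.
move=> rG finF; have [n [rn _ _]] := ray_minus rG finF.
apply: (@region_tail r F (r n)) => //.
have nF k : (n <= k)%N -> ~ F (r k).
  by move=> /subnKC <-; have [] := rn (k - n)%N.
by exists n => //; apply/linked0/nF.
Qed.

Lemma region_ex r F : ray G r -> finite_set F -> exists y, region r F y.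
Proof. by move=> rG /(region_finite rG)[m /(_ m (leqnn _))]; exists (r m). Qed.

(** The main way to compare regions: a connected set avoiding [X] cannot leave
    a region of [G] minus [X]. *)
Lemma region_absorb r X Z a : connected_set Z -> (forall z, Z z -> ~ X z) ->
  Z a -> region r X a -> Z `<=` region r X.
Proof.
move=> cZ ZX Za ra z Zz; apply: (region_linked ra).
exact: linked_sub ZX (cZ _ _ Za Zz).
Qed.

Lemma region_eq r s X a : ray G r -> ray G s ->
  region r X a -> region s X a -> region r X = region s X.
Proof.
move=> rG sG ra sa; apply/seteqP; split.
- apply: region_absorb sa => //; first exact: region_connected.
  by move=> z /region_notin.
- apply: region_absorb ra => //; first exact: region_connected.
  by move=> z /region_notin.
Qed.

(** Only the trace of [Y] on the region matters: a set that misses the region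
    leaves it connected. *)
Lemma region_shrink r X Y : ray G r -> (forall z, region r X z -> ~ Y z) ->
  region r X `<=` region r Y.
Proof.
move=> rG XY y ry; have [m mX] := region_tail rG ry.
apply: (@region_absorb r Y _ (r m)) ry => //; first exact: region_connected.
  exact: mX.
by exists m => [k /mX/XY//|]; exact/linked0/XY/mX.
Qed.

(** * Infinitely connected pairs of vertices *)

Definition inseparable x y :=
  forall F, finite_set F -> ~ F x -> ~ F y -> linked (~` F) x y.

(** The closure property needed of the growing vertex set. As it is checked pair
    by pair, it survives increasing unions and gluing along components, yet it
    controls all finite sets at once ([linked_trace]). *)
Definition pairs_inseparable M C := forall x y u v, M x -> M y ->
  adj G x u -> linked (C `\` M) u v -> adj G v y -> inseparable x y.

(** Connections past [F] between vertices of [M] depend only on the trace of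
    [F] on [M]: each detour of a walk outside [M] is rerouted past [F]. *)
Lemma linked_trace M C F x y : pairs_inseparable M C -> finite_set F ->
  M x -> M y -> ~ F x -> ~ F y ->
  linked (C `\` (F `&` M)) x y -> linked (~` F) x y.
Proof.
move=> MC finF Mx My Fx Fy xy.
suff : (M y -> linked (~` F) x y) /\ (~ M y -> exists h u, [/\ M h,
    linked (~` F) x h, adj G h u & linked (C `\` M) u y]) by case=> /(_ My).
elim: xy {My Fy} => [_|y' z xy [IHM IHN] yz [Cz FMz]].
  by split=> // _; exact: linked0.
have Fz : M z -> ~ F z by move=> Mz Fz; apply: FMz.
split=> Mz; have [My|My] := pselect (M y').
- exact: linkedS (IHM My) yz (Fz Mz).
- have [h [u [Mh xh hu uy]]] := IHN My.
  apply: linked_trans (xh) _.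
  exact: MC Mh Mz hu uy yz F finF (linked_r xh) (Fz Mz).
- exists y', z; split=> //; first exact: IHM.
  exact/linked0.
- have [h [u [Mh xh hu uy]]] := IHN My.
  exists h, u; split=> //; exact: linkedS uy yz _.
Qed.

(** An infinite set of vertices no two of which are finitely separable is
    met infinitely often by a ray: keep extending a path from one vertex of
    the set to another while avoiding its earlier vertices. *)
Lemma inseparable_ray (B : set T) : ~ finite_set B ->
  (forall x y, B x -> B y -> inseparable x y) ->
  exists2 r, ray G r & forall m, exists2 k, (m <= k)%N & B (r k).
Proof.
move=> infB Binsep.
pose e a b := `[<adj G a b>].
have fresh (l : seq T) : exists2 y, B y & y \notin l.
  apply: contrapT => nofresh; apply: infB.
  apply: (@sub_finite_set _ _ [set` l]) => [y By|]; last exact: finite_seq.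
  by apply: contrapT => /= /negP yl; apply: nofresh; exists y.
have [x0 Bx0 _] := fresh [::].
pose valid p := [/\ path e x0 p, uniq (x0 :: p) & B (last x0 p)].
have /choice[next nextP] : forall p, exists p', valid p ->
    valid p' /\ exists2 q, (0 < size q)%N & p' = p ++ q.
  move=> p; have [vp|?] := pselect (valid p); last by exists [::].
  have [px pU Bp] := vp; have [y By yp] := fresh (x0 :: p).
  (* The walk to [y] may reuse the current endpoint, but no earlier vertex. *)
  have notlast z : z \in belast x0 p -> z <> last x0 p.
    move=> zp zl; move: pU; rewrite lastI rcons_uniq => /andP[/negP + _].
    by rewrite -zl.
  have belastS z : z \in belast x0 p -> z \in x0 :: p.
    by move=> zp; rewrite lastI mem_rcons inE zp orbT.
  have [] := @linked_path (~` [set` belast x0 p]) (last x0 p) y.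
    apply: Binsep => //.
      by move=> /= /notlast.
    by move=> /= /belastS; exact/negP.
  move=> q [qpath qlast quniq qavoid].
  exists (p ++ q) => _; split; last first.
    exists q => //; case: q qlast {qpath quniq qavoid} => //= py.
    by move: yp; rewrite -py mem_last.
  split; first by rewrite cat_path px.
    rewrite -cat_cons cat_uniq pU /=.
    move: quniq => /= /andP[lastq ->]; rewrite andbT.
    apply/hasPn => z zq; rewrite lastI mem_rcons inE negb_or.
    apply/andP; split; first by apply: contraNneq lastq => <-.
    by apply/negP; apply: qavoid; rewrite inE zq orbT.
  by rewrite last_cat qlast.
(* The paths extend each other, so that their entries stabilize to a ray. *)
pose p n := iter n next [::].
have vp n : valid (p n) by elim: n => //= n /nextP[].
have pS n : exists2 q, (0 < size q)%N & p n.+1 = p n ++ q.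
  by have [_] := nextP _ (vp n).
have size_p n : (n <= size (p n))%N.
  elim: n => // n IH; have [q q0 ->] := pS n.
  by rewrite size_cat -addn1 leq_add.
have pD n k : exists q, p (n + k)%N = p n ++ q.
  elim: k => [|k [q IH]]; first by exists [::]; rewrite addn0 cats0.
  by have [q' _ E] := pS (n + k)%N; exists (q ++ q'); rewrite addnS E IH catA.
pose r i := nth x0 (x0 :: p i) i.
have rE n i : (i <= size (p n))%N -> r i = nth x0 (x0 :: p n) i.
  move=> lei; have stable k l : (i <= size (p k))%N -> (k <= l)%N ->
      nth x0 (x0 :: p l) i = nth x0 (x0 :: p k) i.
    move=> ik /subnKC <-; have [q ->] := pD k (l - k)%N.
    by rewrite -cat_cons nth_cat /= ltnS ik.
  rewrite -(stable _ (maxn n i) lei (leq_maxl _ _)).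
  by rewrite (stable _ _ (size_p i) (leq_maxr n i)).
have radj i : adj G (r i) (r i.+1).
  rewrite (rE i.+1 i.+1) ?size_p// (rE i.+1 i) ?(leq_trans _ (size_p _))//.
  have [/(pathP x0)/(_ i (size_p i.+1))/asboolP //] := vp i.+1.
exists r.
  split=> //; last first.
    move=> i j; wlog ij : i j / (i <= j)%N => [wl|].
      by have [/wl//|/ltnW/wl + /esym] := leqP i j; move=> + ji => /(_ ji).
    rewrite (rE j i) ?(leq_trans ij)// (rE j j)//.
    move/eqP; rewrite nth_uniq ?ltnS ?(leq_trans ij)//; first by move/eqP.
    by have [] := vp j.
  move=> i; have [sub _] := edges_pairs (radj i); apply: sub; by left.
move=> m; exists (size (p m)); first exact: size_p.
rewrite (rE m)// -last_nth.
by have [] := vp m.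
Qed.

(** * Covering inside one component *)

(** [U e f] is to be read as: the end of [f] lies in the open set assigned to
    the end of [e]. *)
Context (U : (nat -> T) -> (nat -> T) -> Prop).

Definition good e F := forall f, ray G f -> region f F = region e F -> U e f.

Hypothesis good_ex : forall e, ray G e -> exists2 F, finite_set F & good e F.

(** Goodness depends on the region only, and not on the set that cuts it. *)
Lemma good_sub e F F' : ray G e -> finite_set F' ->
  region e F' `<=` region e F -> good e F -> good e F'.
Proof.
move=> eG finF' sub gF f fG fe; apply: gF => //.
have [a fa] := region_ex fG finF'.
apply: (@region_eq _ _ _ a) => //; last by apply: sub; rewrite -fe.
by apply: region_shrink fa => // z; rewrite fe => /sub/region_notin.
Qed.

Definition covered (A : set ((nat -> T) * set T)) f :=
  exists2 p, A p & region f p.2 = region p.1 p.2.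

Lemma covered_sub (A A' : set ((nat -> T) * set T)) f :
  A `<=` A' -> covered A f -> covered A' f.
Proof. by move=> Alim' [p /Alim' A'p fp]; exists p. Qed.

Definition adherent B e := forall F, finite_set F -> region e F `&` B !=set0.

Definition boundary C : set T := [set y | ~ C y /\ exists2 c, C c & adj G c y].

(** What one level adds inside a component [C] with a finite boundary: the
    vertices [B] and the pairs [A]. The clause [lc_absorb] is the one that
    survives to the limit: it excludes uncovered ends having a good
    neighbourhood that contains all of [B], whatever is added to [B] at later
    levels. *)
Record local_cover C B (A : set ((nat -> T) * set T)) : Prop := LocalCover {
  lc_sub : B `<=` C;
  lc_ex : B !=set0;
  lc_insep : pairs_inseparable (boundary C `|` B) C;
  lc_ray : forall p, A p -> ray G p.1;
  lc_in : forall p, A p -> region p.1 (boundary C) = C;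
  lc_fin : forall p, A p -> finite_set p.2;
  lc_bnd : forall p, A p -> boundary C `<=` p.2;
  lc_mem : forall p, A p -> p.2 `<=` boundary C `|` B;
  lc_good : forall p, A p -> good p.1 p.2;
  lc_adherent : forall e, ray G e -> region e (boundary C) = C ->
    adherent B e -> covered A e;
  lc_absorb : forall e F, ray G e -> region e (boundary C) = C ->
    finite_set F -> boundary C `<=` F -> F `<=` boundary C `|` C -> good e F ->
    B `<=` region e F -> covered A e;
  lc_locfin : forall p, A p ->
    finite_set [set p' | A p' /\ region p'.1 p.2 = region p.1 p.2] }.

Section local.
Context (C : set T) (r0 : nat -> T).
Hypothesis finN : finite_set (boundary C).
Hypothesis r0G : ray G r0.
Hypothesis r0C : region r0 (boundary C) = C.
Local Notation N := (boundary C).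

(** Here [X] cuts off the region of [x], and [M], [L] are the vertices and the
    pairs collected so far. By [cd_abs], the set [F] does not separate the
    collected vertices of the region from [e]. *)
Record candidate (M : seq T) (L : seq ((nat -> T) * set T)) X x e F : Prop :=
  Candidate {
  cd_ray : ray G e;
  cd_in : region e N = C;
  cd_new : ~ covered [set` L] e;
  cd_mem : region e X x;
  cd_fin : finite_set F;
  cd_sub : X `<=` F;
  cd_sup : F `<=` N `|` C;
  cd_good : good e F;
  cd_abs : forall z, z \in M -> region e X z -> region e F z }.

(** The preference for [F = X] amounts to choosing, whenever there is one, an
    end whose open set absorbs the whole region. *)
Definition chosen (M M' : seq T) (L L' : seq ((nat -> T) * set T)) X x : Prop :=
  (L' = L /\ forall e F, ~ candidate M L X x e F) \/
  exists e F, [/\ candidate M L X x e F, L' = (e, F) :: L, F `<=` [set` M'] &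
                  (exists e', candidate M L X x e' X) -> F = X].

Lemma separator_ex x y : exists F, finite_set F /\
  (inseparable x y \/ [/\ ~ F x, ~ F y & ~ linked (~` F) x y]).
Proof.
have [i|ni] := pselect (inseparable x y).
  by exists set0; split=> //; left.
apply: contrapT => noF; apply: ni => F finF Fx Fy.
by apply: contrapT => nl; apply: noF; exists F; split=> //; right; split.
Qed.

Lemma x0_ex : exists x0, C x0.
Proof. by have [y] := region_ex r0G finN; rewrite r0C; exists y. Qed.

(** A task names by their indices, among the collected vertices, a finite set
    and two vertices: the region of the first vertex is searched for a
    candidate, and a separator of both vertices is collected. Reading the code
    of the task off the exponent of 2 makes each task come up infinitely often.
    *)
Definition task n : seq nat * nat * nat :=
  odflt ([::], 0%N, 0%N) (unpickle (logn 2 n)).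

Lemma task_recurs c m : exists2 n, (m <= n)%N & task n = c.
Proof.
exists (2 ^ pickle c * m.*2.+1)%N; last first.
  rewrite /task lognM ?expn_gt0// pfactorK//.
  by rewrite lognE /= dvdn2 /= odd_double addn0 pickleK.
apply: leq_trans (leq_pmull _ _); last by rewrite expn_gt0.
by rewrite -addnn -addSn leq_addl.
Qed.

Lemma construction : exists (x0 : T) (M : nat -> seq T)
    (L : nat -> seq ((nat -> T) * set T)) (sep : T -> T -> set T),
  [/\ C x0 /\ x0 \in M 0%N, L 0%N = [::],
    [set` M 0%N] `<=` N `|` C /\ N `<=` [set` M 0%N],
    (forall x y, finite_set (sep x y) /\ (inseparable x y \/
       [/\ ~ sep x y x, ~ sep x y y & ~ linked (~` sep x y) x y])) &
    forall n, let: (js, i, j) := task n in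
    let K := [set` [seq nth x0 (M n) k | k <- js]] in
    let x := nth x0 (M n) i in let y := nth x0 (M n) j in
    exists q, [/\ M n.+1 = M n ++ q, [set` q] `<=` N `|` C,
      sep x y `&` C `<=` [set` M n.+1] &
      chosen (M n) (M n.+1) (L n) (L n.+1) (N `|` K) x]].
Proof.
have [x0 Cx0] := x0_ex.
have /choice[s sP] := fun p : T * T => separator_ex p.1 p.2.
pose sep x y := s (x, y).
have [lN NE] := (finite_seqP N).1 finN.
pose St := (seq T * seq ((nat -> T) * set T))%type.
pose step n (a b : St) := let: (js, i, j) := task n in
    let K := [set` [seq nth x0 a.1 k | k <- js]] in
    let x := nth x0 a.1 i in let y := nth x0 a.1 j in
    exists q, [/\ b.1 = a.1 ++ q, [set` q] `<=` N `|` C,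
      sep x y `&` C `<=` [set` b.1] & chosen a.1 b.1 a.2 b.2 (N `|` K) x].
have /choice[f fP] : forall na : nat * St, exists b, step na.1 na.2 b.
  move=> [n a]; rewrite /step /=; case: (task n) => [[js i] j].
  set K := [set` _]; set x := nth _ _ i; set y := nth _ _ j.
  have [ls lsE] : exists ls : seq T, sep x y `&` C = [set` ls].
    by apply/finite_seqP; apply: finite_setIl; have [] := sP (x, y).
  have lsC : [set` ls] `<=` N `|` C by rewrite -lsE => z [_ ?]; right.
  have sel e F : candidate a.1 a.2 (N `|` K) x e F ->
      ((exists e', candidate a.1 a.2 (N `|` K) x e' (N `|` K)) ->
        F = N `|` K) -> exists b : St, exists q, [/\ b.1 = a.1 ++ q,
        [set` q] `<=` N `|` C, sep x y `&` C `<=` [set` b.1] &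
        chosen a.1 b.1 a.2 b.2 (N `|` K) x].
    move=> cF pref; have [lF FE] := (finite_seqP F).1 (cd_fin cF).
    exists (a.1 ++ (ls ++ lF), (e, F) :: a.2), (ls ++ lF); split=> //=.
    - move=> z /=; rewrite mem_cat => /orP[zl|zF]; first exact: lsC.
      by apply: (cd_sup cF); rewrite FE.
    - by rewrite lsE => z /= zl; rewrite !mem_cat zl orbT.
    - right; exists e, F; split=> //.
      by rewrite FE => z /= zF; rewrite !mem_cat zF !orbT.
  have [[e ce]|nopref] :=
    pselect (exists e', candidate a.1 a.2 (N `|` K) x e' (N `|` K)).
    exact: sel ce _.
  have [[e [F cF]]|nocand] :=
    pselect (exists e F, candidate a.1 a.2 (N `|` K) x e F).
    exact: sel cF _.
  exists (a.1 ++ ls, a.2), ls; split=> //=.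
    by rewrite lsE => z /= zl; rewrite mem_cat zl orbT.
  by left; split=> // e F cF; apply: nocand; exists e, F.
pose st := fix st n := if n is n'.+1 then f (n', st n')
                       else ((x0 :: lN, [::]) : St).
exists x0, (fun n => (st n).1), (fun n => (st n).2), sep; split=> //.
- by rewrite /= mem_head.
- split=> z /=; last first.
    move=> Nz; have : [set` lN] z by rewrite -NE.
    by rewrite /= inE => ->; rewrite orbT.
  by rewrite inE => /orP[/eqP->|zN]; [right|left; rewrite NE].
- by move=> x y; exact: (sP (x, y)).
- by move=> n; exact: (fP (n, st n)).
Qed.

Section run.
Context (x0 : T) (M : nat -> seq T) (L : nat -> seq ((nat -> T) * set T))
  (sep : T -> T -> set T).
Hypothesis Cx0 : C x0.
Hypothesis M0x0 : x0 \in M 0%N.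
Hypothesis L0 : L 0%N = [::].
Hypothesis M0sup : [set` M 0%N] `<=` N `|` C.
Hypothesis M0N : N `<=` [set` M 0%N].
Hypothesis sepP : forall x y, finite_set (sep x y) /\ (inseparable x y \/
  [/\ ~ sep x y x, ~ sep x y y & ~ linked (~` sep x y) x y]).
Hypothesis step : forall n, let: (js, i, j) := task n in
  let K := [set` [seq nth x0 (M n) k | k <- js]] in
  let x := nth x0 (M n) i in let y := nth x0 (M n) j in
  exists q, [/\ M n.+1 = M n ++ q, [set` q] `<=` N `|` C,
    sep x y `&` C `<=` [set` M n.+1] &
    chosen (M n) (M n.+1) (L n) (L n.+1) (N `|` K) x].

Let B : set T := [set z | C z /\ exists n, z \in M n].
Let A : set ((nat -> T) * set T) := [set p | exists n, p \in L n].

Lemma M_step n : exists2 q, M n.+1 = M n ++ q & [set` q] `<=` N `|` C.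
Proof.
by have := step n; case: (task n) => [[js i] j] /= [q [Mq qC _ _]]; exists q.
Qed.

Lemma M_prefix m n : (m <= n)%N -> exists q, M n = M m ++ q.
Proof.
move=> /subnKC <-; elim: (n - m)%N => [|k [q IH]].
  by exists [::]; rewrite addn0 cats0.
have [q' E _] := M_step (m + k)%N.
by exists (q ++ q'); rewrite addnS E IH catA.
Qed.

Lemma M_mono m n z : (m <= n)%N -> z \in M m -> z \in M n.
Proof. by move=> /M_prefix[q ->]; rewrite mem_cat => ->. Qed.

Lemma M_sup n : [set` M n] `<=` N `|` C.
Proof.
elim: n => // n IH z; have [q -> qC] := M_step n.
by rewrite /= mem_cat => /orP[/IH|/qC].
Qed.

Lemma memM_B n z : z \in M n -> (N `|` B) z.
Proof.
by move=> zM; have [Nz|Cz] := M_sup zM; [left|right; split=> //; exists n].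
Qed.

Lemma NB_memM z : (N `|` B) z -> exists n, z \in M n.
Proof. by move=> [/M0N zM|[_ //]]; exists 0%N. Qed.

Lemma NB_nth n z : z \in M n ->
  forall m, (n <= m)%N -> nth x0 (M m) (index z (M n)) = z.
Proof.
by move=> zM m /M_prefix[q ->]; rewrite nth_cat index_mem zM nth_index.
Qed.

Lemma memM_common (s : seq T) : (forall z, z \in s -> (N `|` B) z) ->
  exists n, forall z, z \in s -> z \in M n.
Proof.
elim: s => [|y s IH] sB; first by exists 0%N.
have [m sm] : exists m, forall z, z \in s -> z \in M m.
  by apply: IH => z zs; apply: sB; rewrite inE zs orbT.
have [n yn] := NB_memM (sB y (mem_head _ _)).
exists (maxn m n) => z; rewrite inE => /orP[/eqP->|/sm].
  exact: M_mono (leq_maxr _ _) yn.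
exact/M_mono/leq_maxl.
Qed.

(** The vertices of [K] and [x] keep their indices once they are collected, so
    that a single task refers to them from then on. *)
Lemma chosen_recurs K x : finite_set K -> K `<=` N `|` B -> (N `|` B) x ->
  forall m, exists n, [/\ (m <= n)%N, x \in M n &
    chosen (M n) (M n.+1) (L n) (L n.+1) (N `|` K) x].
Proof.
move=> finK KB Bx m; have [s sE] := (finite_seqP K).1 finK.
have [l xsl] : exists l, forall z, z \in x :: s -> z \in M l.
  apply: memM_common => z; rewrite inE => /orP[/eqP->//|zs].
  by apply: KB; rewrite sE.
have xl : x \in M l by apply: xsl; rewrite mem_head.
pose js := [seq index z (M l) | z <- s].
have [n mln tn] := task_recurs (js, index x (M l), 0%N) (maxn m l).
have ln : (l <= n)%N by apply: leq_trans mln; exact: leq_maxr.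
exists n; split.
- by apply: leq_trans mln; exact: leq_maxl.
- exact: M_mono xl.
- have := step n; rewrite tn /= => -[q [_ _ _]].
  rewrite (NB_nth xl ln) -map_comp.
  rewrite [X in [set` X]](_ : _ = s) -?sE//.
  rewrite -[RHS]map_id; apply/eq_in_map => z zs /=.
  by apply: NB_nth => //; apply: xsl; rewrite inE zs orbT.
Qed.

Lemma sep_B x y : (N `|` B) x -> (N `|` B) y -> sep x y `&` C `<=` B.
Proof.
move=> Bx By z [sz Cz]; split=> //.
have [l xyl] : exists l, forall z, z \in [:: x; y] -> z \in M l.
  by apply: memM_common => a; rewrite !inE => /orP[] /eqP->.
have xl : x \in M l by apply: xyl; rewrite !inE eqxx.
have yl : y \in M l by apply: xyl; rewrite !inE eqxx orbT.
have [n ln tn] := task_recurs ([::], index x (M l), index y (M l)) l.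
exists n.+1; have := step n; rewrite tn /= => -[q [_ _ + _]].
by rewrite (NB_nth xl ln) (NB_nth yl ln); exact.
Qed.

(** A path with interior in [C] outside [B] between separable vertices would
    have to meet their separator, whose part in [C] was put into [B]. *)
Lemma B_insep : pairs_inseparable (N `|` B) C.
Proof.
move=> x y u v Bx By xu uv vy.
have [_ [//|[sx sy]]] := sepP x y; case.
have sub : linked (~` sep x y) u v.
  apply: linked_sub uv => z [Cz NBz] sz; apply: NBz; right.
  exact: (sep_B Bx By).
apply: linkedS _ vy sy; apply: linked_trans (sub).
exact: linked_edge sx (linked_l sub) xu.
Qed.

Lemma L_mono m n p : (m <= n)%N -> p \in L m -> p \in L n.
Proof.
move=> /subnKC <- pm; elim: (n - m)%N => [|k IH]; first by rewrite addn0.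
rewrite addnS; have := step (m + k); case: (task _) => [[js i] j] /=.
by move=> [q [_ _ _ [[->//]|[e [F [_ -> _ _]]]]]]; rewrite inE IH orbT.
Qed.

Lemma L_new n p : p \in L n.+1 -> p \notin L n -> exists X x,
  [/\ candidate (M n) (L n) (N `|` X) x p.1 p.2 & p.2 `<=` [set` M n.+1]].
Proof.
have := step n; case: (task n) => [[js i] j] /=.
move=> [q [_ _ _ [[->]|[e [F [cF -> FM _]]]]]]; first by move=> _ ->.
rewrite inE => /orP[/eqP->|-> //] _ /=.
by exists [set` [seq nth x0 (M n) k | k <- js]], (nth x0 (M n) i).
Qed.

Lemma A_born p : A p -> exists n X x,
  candidate (M n) (L n) (N `|` X) x p.1 p.2 /\ p.2 `<=` [set` M n.+1].
Proof.
move=> [n]; elim: n => [|n IH]; first by rewrite L0.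
have [/IH//|pn] := boolP (p \in L n).
by move=> /L_new /(_ pn)[X [x [? ?]]]; exists n, X, x.
Qed.

Lemma A_late n p p' : p \in L n -> A p' -> p' \notin L n ->
  region p'.1 p.2 <> region p.1 p.2.
Proof.
move=> pn [m p'm] p'n.
have nm : (n <= m)%N.
  by apply: contraNT p'n; rewrite -ltnNge => /ltnW/L_mono; exact.
move: p'm; rewrite -(subnKC nm).
elim: (m - n)%N => [|k IH]; first by rewrite addn0 (negbTE p'n).
have [/IH //|p'k] := boolP (p' \in L (n + k)%N).
rewrite addnS => /L_new /(_ p'k)[X [x [cF _]]] pp'.
by apply: (cd_new cF); exists p => //=; exact: L_mono (leq_addr _ _) pn.
Qed.

(** An end is uncovered at the time when it is chosen, so a neighbourhood can
    contain only ends chosen earlier. *)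
Lemma A_locfin p : A p ->
  finite_set [set p' | A p' /\ region p'.1 p.2 = region p.1 p.2].
Proof.
move=> [n pn]; apply: (@sub_finite_set _ _ [set` L n]); last exact: finite_seq.
move=> p' [Ap' pp']; apply: contrapT => /= /negP p'n.
exact: A_late pn Ap' p'n pp'.
Qed.

Section uncovered.
Context (e : nat -> T).
Hypothesis eG : ray G e.
Hypothesis eC : region e N = C.
Hypothesis eA : ~ covered A e.

Lemma uncovered_stage n : ~ covered [set` L n] e.
Proof. by move=> eL; apply/eA/covered_sub/eL => p pn; exists n. Qed.

(** Once a set of collected vertices is good for an uncovered end [e], the pair
    of the two is a preferred candidate; the pair chosen instead covers the same
    region, hence [e]. *)
Lemma chosen_uncovered F d : finite_set F -> N `<=` F -> F `<=` N `|` B ->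
  good e F -> region e F d -> (N `|` B) d -> False.
Proof.
move=> finF NF FB gF ed Bd.
have [n [_ _ cn]] := chosen_recurs finF FB Bd 0%N.
have NUF : N `|` F = F by apply/setUidPr.
have ce : candidate (M n) (L n) (N `|` F) d e (N `|` F).
  rewrite NUF; split=> //; first exact: uncovered_stage.
  by move=> z /FB[Nz|[Cz _]]; [left|right].
have [[_ /(_ _ _ ce)//]|[e' [F' [ce' Ln _ pref]]]] := cn.
have F'E : F' = F by rewrite pref//; exists e.
apply: eA; exists (e', F'); first by exists n.+1; rewrite Ln mem_head.
rewrite /= F'E; have := cd_mem ce'; rewrite NUF => e'd.
exact: region_eq eG (cd_ray ce') ed e'd.
Qed.

Context (X : set T) (x : T) (F : set T).
Hypothesis finX : finite_set X.
Hypothesis NX : N `<=` X.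
Hypothesis XB : X `<=` N `|` B.
Hypothesis Bx : (N `|` B) x.
Hypothesis ex : region e X x.
Hypothesis finF : finite_set F.
Hypothesis XF : X `<=` F.
Hypothesis FC : F `<=` N `|` C.
Hypothesis gF : good e F.
Hypothesis BF : forall z, B z -> region e X z -> region e F z.

(** [H] is the finite set of a pair [(f, H)] chosen at step [n] for the region
    cut off by [X] around [x] and [e]. As [e] remains uncovered, [H] separates
    it from [f], hence also from all vertices of this region collected before
    step [n]. *)
Definition stage n H := exists f, [/\ [/\ finite_set H, X `<=` H &
    H `<=` [set` M n.+1]], x \in M n,
  forall z, z \in M n -> region e X z -> region f H z &
  forall z, region e H z -> ~ region f H z].

Lemma region_XC z : region e X z -> C z.
Proof.
by rewrite -eC; apply: region_shrink => // y /region_notin + /NX.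
Qed.

Lemma stage_ex m : exists n H, (m <= n)%N /\ stage n H.
Proof.
have NUX : N `|` X = X by apply/setUidPr.
have [n [mn xn]] := chosen_recurs finX XB Bx m; rewrite NUX => cn.
have ce : candidate (M n) (L n) X x e F.
  split=> //; first exact: uncovered_stage.
  move=> z zM ez; apply: BF => //; split; first exact: region_XC.
  by exists n.
have [[_ /(_ _ _ ce)//]|[f [H [cf Ln HM _]]]] := cn.
have XE : region f X = region e X.
  exact: region_eq (cd_ray cf) eG (cd_mem cf) ex.
exists n, H; split=> //; exists f; split=> //.
- by split=> //; case: cf.
- by rewrite -XE; exact: cd_abs cf.
- move=> z ez fz; apply: eA; exists (f, H).
    by exists n.+1; rewrite Ln mem_head.
  exact: region_eq eG (cd_ray cf) ez fz.
Qed.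

Lemma stage_sub n H : stage n H -> region e H `<=` region e X.
Proof.
move=> [f [[_ XH _] _ _ _]].
by apply: region_shrink => // y /region_notin + /XH.
Qed.

(** [H] is collected before the later step [m], so it lies on the side of the
    end chosen there. *)
Lemma stage_far n H m H' z : stage n H -> stage m H' -> (n < m)%N ->
  region e X z -> H z -> ~ H' z /\ ~ region e H' z.
Proof.
move=> [f [[_ _ HM] _ _ _]] [f' [_ _ abs dis]] nm ez Hz.
have f'z : region f' H' z by apply: abs => //; apply: M_mono nm _; exact: HM.
by split; [exact: region_notin f'z|move=> /dis].
Qed.

Lemma stage_mono n H m H' : stage n H -> stage m H' -> (n < m)%N ->
  region e H' `<=` region e H.
Proof.
move=> sn sm nm; apply: region_shrink => // z ez Hz.
by have [_] := stage_far sn sm nm (stage_sub sm ez) Hz.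
Qed.

(** Going along a walk from [x], which no side of [e] contains: to enter the
    later side, the walk would have to cross both [H] and [H'] at the vertex
    [u]. *)
Lemma stage_leaves y : linked (~` X) x y ->
  exists n H, stage n H /\ ~ region e H y.
Proof.
elim=> [_|u v xu [n [H [sn eu]]] uv Xv].
  have [n [H [_ sn]]] := stage_ex 0; exists n, H; split=> //.
  by case: (sn) => f [_ xn abs dis] /dis; apply; exact: abs.
have [m [H' [nm sm]]] := stage_ex n.+1.
exists m, H'; split=> // ev.
have Hu : H u.
  apply: contrapT => nHu; apply: eu.
  exact: region_adj (stage_mono sn sm nm ev) (adjC uv) nHu.
have [H'u] := stage_far sn sm nm (region_linked ex xu) Hu; apply.
exact: region_adj ev (adjC uv) H'u.
Qed.

Lemma stage_avoids (s : seq T) :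
  exists n H, stage n H /\ forall y, y \in s -> ~ region e H y.
Proof.
elim: s => [|y s [n [H [sn IH]]]].
  by have [n [H [_ sn]]] := stage_ex 0; exists n, H.
have [k [H1 [sk ey]]] : exists k H1, stage k H1 /\ ~ region e H1 y.
  have [ey|ey] := pselect (region e X y).
    by apply: stage_leaves; apply: linked_sub (region_connected eG ex ey) => z;
      exact: region_notin.
  by exists n, H; split=> // /(stage_sub sn).
have [m [H' []]] := stage_ex (maxn n k).+1; rewrite gtn_max => /andP[nm km] sm.
exists m, H'; split=> // z; rewrite inE => /orP[/eqP->|/IH ez].
  by move/(stage_mono sk sm km).
by move/(stage_mono sn sm nm).
Qed.

(** Some side of [e] avoids [F], hence the set [H] which cuts it off is good for
    [e]. The next stage provides a collected vertex [d] of this side, by which a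
    task can refer to it. *)
Lemma no_uncovered : False.
Proof.
have [lF FE] := (finite_seqP F).1 finF.
have [n [H [sn HF]]] := stage_avoids lF.
have [f [[finH XH HM] _ _ _]] := sn.
have gH : good e H.
  apply: good_sub gF => //; apply: region_shrink => // z ez Fz.
  by apply: (HF z) => //; have : [set` lF] z by rewrite -FE.
have [m [H' [nm sm]]] := stage_ex n.+1.
have [f' [[finH' _ HM'] xm abs dis]] := sm.
have [a ea] := region_ex eG finH'.
have eXa := stage_sub sm ea.
have nex : ~ region e H' x by move=> /dis; apply; exact: abs.
(* [d] lies on the frontier of the smaller side, so in [H']. *)
have [c [d [_ ec ed eXd cd]]] :=
  linked_exit (region_connected eG eXa ex) ea nex.
have H'd : H' d.
  by apply: contrapT => nd; apply: ed; exact: region_adj ec cd nd.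
have nHd : ~ H d by move=> Hd; have [] := stage_far sn sm nm eXd Hd.
apply: (@chosen_uncovered H d) => //.
- exact: subset_trans XH.
- by move=> z /HM /memM_B.
- exact: region_adj (stage_mono sn sm nm ec) cd nHd.
- exact/memM_B/HM'.
Qed.

End uncovered.

Lemma run_cover : local_cover C B A.
Proof.
split.
- by move=> z [].
- by exists x0; split=> //; exists 0%N.
- exact: B_insep.
- by move=> p /A_born[n [X [x [[]]]]].
- by move=> p /A_born[n [X [x [[]]]]].
- by move=> p /A_born[n [X [x [[]]]]].
- by move=> p /A_born[n [X [x [/cd_sub XF _]]]] z Nz; apply: XF; left.
- by move=> p /A_born[n [X [x [_ FM]]]] z /FM/memM_B.
- by move=> p /A_born[n [X [x [[]]]]].
- move=> e eG eC adh; apply: contrapT => eA.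
  have [F0 finF0 gF0] := good_ex eG.
  (* [F] replaces [F0] within [C], and is good because its region misses [F0];
     its trace [X] on the collected vertices names a task. *)
  pose F := N `|` (F0 `&` C).
  have finF : finite_set F.
    by rewrite finite_setU; split=> //; exact: finite_setIl.
  have eFC : region e F `<=` C.
    rewrite -[X in _ `<=` X]eC; apply: region_shrink => // z /region_notin + Nz.
    by apply; left.
  have gF : good e F.
    apply: good_sub gF0 => //; apply: region_shrink => // z ez F0z.
    by apply: (region_notin ez); right; split=> //; exact: eFC.
  pose X := F `&` (N `|` B).
  have NX : N `<=` X by move=> z Nz; split; left.
  have [h [eh Bh]] := adh F finF.
  have eX : region e F `<=` region e X.
    by apply: region_shrink => // z /region_notin + [].
  apply: (@no_uncovered e eG eC eA X h F) => //.
  + exact: finite_setIl.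
  + by move=> z [].
  + by right.
  + exact: eX.
  + by move=> z [].
  + by move=> z [Nz|[_ Cz]]; [left|right].
  move=> z Bz ez; apply: region_linked (eh) _.
  have nF y : B y -> region e X y -> ~ F y.
    by move=> By /region_notin nX Fy; apply: nX; split=> //; right.
  apply: (linked_trace B_insep finF) => //; [by right|by right| | |].
  + exact: region_notin eh.
  + exact: nF.
  apply: linked_sub (region_connected eG (eX _ eh) ez) => y ey.
  split; last exact: region_notin ey.
  rewrite -eC; apply: region_shrink ey => // w /region_notin + Nw.
  by apply; exact: NX.
- move=> e F eG eC finF NF FC gF BF; apply: contrapT => eA.
  apply: (@no_uncovered e eG eC eA N x0 F) => //.
  + by right; split=> //; exists 0%N.
  + by rewrite eC.
  + by move=> z /BF.
- exact: A_locfin.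
Qed.

End run.

Lemma local_cover_ex : exists B A, local_cover C B A.
Proof.
have [x0 [M [L [sep [[Cx0 M0x0] L0 [M0sup M0N] sepP step]]]]] := construction.
by exists [set z | C z /\ exists n, z \in M n], [set p | exists n, p \in L n];
  apply: run_cover step.
Qed.

End local.

(** * Covering all ends *)

(** The invariant of the levels: it makes the boundaries of the components that
    still contain uncovered ends finite. *)
Record partial_cover H (A : set ((nat -> T) * set T)) : Prop := PartialCover {
  pc_insep : pairs_inseparable H setT;
  pc_ray : forall p, A p -> ray G p.1;
  pc_fin : forall p, A p -> finite_set p.2;
  pc_mem : forall p, A p -> p.2 `<=` H;
  pc_good : forall p, A p -> good p.1 p.2;
  pc_adherent : forall e, ray G e -> adherent H e -> covered A e }.

(** A pair of [A] whose finite set lies in [H] covers all ends of a component of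
    [G - H], or none of them. *)
Lemma covered_component H A p e c : A p -> ray G p.1 -> p.2 `<=` H ->
  ray G e -> region e H c -> region p.1 p.2 c -> covered A e.
Proof.
move=> Ap pG pH eG ec pc; exists p => //; apply: (region_eq eG pG _ pc).
by apply: region_shrink ec => // z /region_notin + /pH.
Qed.

Lemma boundary_region H e : boundary (region e H) `<=` H.
Proof.
move=> y [ny [c ec yc]]; apply: contrapT => Hy; apply: ny.
exact: region_adj ec yc Hy.
Qed.

Lemma region_boundary H e c : ray G e -> region e H c ->
  region e (boundary (region e H)) = region e H.
Proof.
move=> eG ec.
have sub : region e H `<=` region e (boundary (region e H)).
  by apply: region_shrink => // z ez [].
apply/seteqP; split=> // y ey; apply: contrapT => ny.
have [u [v [_ eu ev bv uv]]] :=
  linked_exit (region_connected eG (sub _ ec) ey) ec ny.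
by apply: (region_notin bv); split=> //; exists u.
Qed.

(** An infinite boundary would be met infinitely often by a ray, whose end is then
    adherent to [H]. The pair of [A] covering it would cover the ends of the
    component as well. *)
Lemma uncovered_boundary H A e : partial_cover H A -> ray G e ->
  ~ covered A e -> [/\ finite_set (boundary (region e H)) &
    region e (boundary (region e H)) = region e H].
Proof.
move=> HA eG eA.
have [F finF eFH] : exists2 F, finite_set F & forall z, region e F z -> ~ H z.
  apply: contrapT => nF; apply: eA; apply: (pc_adherent HA) => // F finF.
  apply: contrapT => F0; apply: nF; exists F => // z ez Hz.
  by apply: F0; exists z.
have [c ec] : exists c, region e H c.
  have [c ec] := region_ex eG finF; exists c.
  exact: region_shrink ec.
split; last exact: region_boundary ec.
apply: contrapT => infN.
have [|s sG sN] := inseparable_ray infN.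
  move=> x y Nx Ny; have [_ [u eu ux]] := Nx; have [_ [v ev vy]] := Ny.
  apply: (pc_insep HA) (adjC ux) _ vy; [exact: boundary_region Nx| |].
    exact: boundary_region Ny.
  by apply: linked_sub (region_connected eG eu ev) => z /region_notin.
have [|p Ap sp] := pc_adherent HA sG.
  move=> F' finF'; have [m sm] := region_finite sG finF'.
  have [k mk Nk] := sN m; exists (s k).
  by split; [exact: sm|exact: boundary_region Nk].
have [m sm] := region_finite sG (pc_fin HA Ap).
have [k mk [_ [d ed dsk]]] := sN m.
apply: eA; apply: (covered_component Ap (pc_ray HA Ap) (pc_mem HA Ap) eG ed).
rewrite -sp; apply: region_adj (sm _ mk) (adjC dsk) _.
by move=> /(pc_mem HA Ap); exact: region_notin ed.
Qed.

Section levels.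
(** [g C] provides the local cover of [C]. As a function of [C] alone, it does
    not depend on the ray by which [C] is given. *)
Context (g : set T -> set T * set ((nat -> T) * set T)).
Hypothesis gP : forall C e, finite_set (boundary C) -> ray G e ->
  region e (boundary C) = C -> local_cover C (g C).1 (g C).2.

Definition extend (HA : set T * set ((nat -> T) * set T)) :=
  let new e := ray G e /\ ~ covered HA.2 e in
  (HA.1 `|` \bigcup_(e in new) (g (region e HA.1)).1,
   HA.2 `|` \bigcup_(e in new) (g (region e HA.1)).2).

Lemma extend_local H A e : partial_cover H A -> ray G e -> ~ covered A e ->
  local_cover (region e H) (g (region e H)).1 (g (region e H)).2.
Proof.
move=> HA eG eA; have [fN eN] := uncovered_boundary HA eG eA.
exact: gP eG eN.
Qed.

Lemma extend_mem H A e z : partial_cover H A -> ray G e -> ~ covered A e ->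
  (extend (H, A)).1 z -> region e H z -> (g (region e H)).1 z.
Proof.
move=> HA eG eA [Hz /region_notin //|[f [fG fA] /= fz] ez].
have fC := lc_sub (extend_local HA fG fA) fz.
by rewrite (region_eq eG fG ez fC).
Qed.

Lemma extend_cover H A : partial_cover H A ->
  partial_cover (extend (H, A)).1 (extend (H, A)).2.
Proof.
move=> HA; set H' := (extend _).1; set A' := (extend _).2.
have Hlim' : H `<=` H' by move=> z; left.
have Alim' : A `<=` A' by move=> z; left.
have newA e p : ray G e -> ~ covered A e -> (g (region e H)).2 p -> A' p.
  by move=> eG eA gp; right; exists e.
have mem p : A' p -> A p \/ exists e, [/\ ray G e, ~ covered A e &
    (g (region e H)).2 p].
  by move=> [Ap|[e [eG eA] gp]]; [left|right; exists e].
have newH e : ray G e -> ~ covered A e -> (g (region e H)).1 `<=` H'.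
  by move=> eG eA z gz; right; exists e.
split.
(* If an endpoint of the path is in a new part of some component, then the
   interior of the path stays in this component. *)
- have side x y u v e : ray G e -> ~ covered A e -> (g (region e H)).1 x ->
      H' y -> adj G x u -> linked (setT `\` H') u v -> adj G v y ->
      inseparable x y.
    move=> eG eA gx H'y xu uv vy.
    have lc := extend_local HA eG eA.
    have uH : linked (~` H) u v by apply: linked_sub uv => z [_ H'z] /Hlim'.
    have eu : region e H u.
      exact: region_adj (lc_sub lc gx) xu (linked_l uH).
    have ez z : linked (~` H) u z -> region e H z by exact: region_linked.
    apply: (lc_insep lc _ _ xu _ vy); first by right.
      have [ey|ey] := pselect (region e H y).
        by right; exact: extend_mem HA _ _ _ _.
      by left; split=> //; exists v => //; exact: ez.
    apply: linked_sub (linked_in uv) => z uz; have [_ H'z] := linked_r uz.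
    have ezz : region e H z.
      by apply: ez; apply: linked_sub uz => w [_ H'w] /Hlim'.
    split=> // -[[]//|gz]; apply: H'z; exact: newH gz.
  move=> x y u v H'x H'y xu uv vy.
  case: (H'x) => [Hx|[e [eG eA] gx]]; last exact: side gx H'y xu uv vy.
  case: (H'y) => [Hy|[e [eG eA] gy]].
    apply: (pc_insep HA Hx Hy xu _ vy).
    by apply: linked_sub uv => z [_ H'z]; split=> // /Hlim'.
  move=> F finF Fx Fy; apply: linked_sym.
  by apply: (side y x v u e) => //; [exact: adjC|exact: linked_sym|exact: adjC].
- move=> p /mem[/(pc_ray HA)//|[e [eG eA gp]]].
  exact: (lc_ray (extend_local HA eG eA) gp).
- move=> p /mem[/(pc_fin HA)//|[e [eG eA gp]]].
  exact: (lc_fin (extend_local HA eG eA) gp).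
- move=> p /mem[Ap|[e [eG eA gp]]] z pz; first by left; exact: (pc_mem HA Ap).
  case: (lc_mem (extend_local HA eG eA) gp pz) => [/boundary_region|].
    by left.
  exact: newH.
- move=> p /mem[/(pc_good HA)//|[e [eG eA gp]]].
  exact: (lc_good (extend_local HA eG eA) gp).
- move=> e eG adh; apply: contrapT => eA'.
  have eA : ~ covered A e by move=> eA; apply: eA'; exact: covered_sub eA.
  have lc := extend_local HA eG eA.
  have [fN eN] := uncovered_boundary HA eG eA.
  apply: eA'; apply: (@covered_sub (g (region e H)).2).
    by move=> p; exact: newA.
  apply: (lc_adherent lc) => // F finF.
  have [|h [eh H'h]] := adh (F `|` boundary (region e H)).
    by rewrite finite_setU.
  exists h; split.
    by apply: region_shrink eh => // z /region_notin + Fz; apply; left.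
  apply: (extend_mem HA) => //; rewrite -eN.
  by apply: region_shrink eh => // z /region_notin + Nz; apply; right.
Qed.

Definition level n := iter n extend (set0, set0).
Local Notation H_ n := (level n).1.
Local Notation A_ n := (level n).2.

Lemma level_cover n : partial_cover (H_ n) (A_ n).
Proof.
elim: n => [|n IH].
  split=> //= e eG adh.
  by have [? []] := adh set0 (@finite_set0 _).
move: IH; rewrite /level iterS; case: (iter n _ _) => H A.
exact: extend_cover.
Qed.

Lemma level_mono m n : (m <= n)%N -> H_ m `<=` H_ n /\ A_ m `<=` A_ n.
Proof.
move=> /subnKC <-; elim: (n - m)%N => [|k [IHH IHA]].
  by rewrite addn0; split=> z.
by rewrite addnS; split=> z; [move/IHH|move/IHA]; left.
Qed.

Lemma level_born n p : A_ n p -> exists m e, [/\ (m < n)%N, ray G e,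
  ~ covered (A_ m) e & (g (region e (H_ m))).2 p].
Proof.
elim: n => [//|n IH] [/IH[m [e [mn eG eA gp]]]|[e [eG eA] gp]].
  by exists m, e; split=> //; exact: ltnW.
by exists n, e.
Qed.

Let Hlim := \bigcup_n H_ n.
Let Alim := \bigcup_n A_ n.

Lemma union_insep : pairs_inseparable Hlim setT.
Proof.
move=> x y u v [m _ mx] [n _ ny] xu uv vy.
apply: (pc_insep (level_cover (maxn m n))) xu _ vy.
- by have [+ _] := level_mono (leq_maxl m n); exact.
- by have [+ _] := level_mono (leq_maxr m n); exact.
- apply: linked_sub uv => z [_ Hz]; split=> // Hmnz.
  by apply: Hz; exists (maxn m n).
Qed.

Lemma union_finite F : finite_set F -> exists n, F `&` Hlim `<=` H_ n.
Proof.
move=> /finite_seqP[s ->]; elim: s => [|y s [n IH]].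
  by exists 0%N => z [].
have [[m _ my]|ny] := pselect (Hlim y).
  exists (maxn m n) => z [/= + Hlz]; rewrite inE => /orP[/eqP->|zs].
    by have [+ _] := level_mono (leq_maxl m n); exact.
  by have [+ _] := level_mono (leq_maxr m n); apply; exact: IH.
exists n => z [/= + Hlz]; rewrite inE => /orP[/eqP zy|zs].
  by rewrite zy in Hlz.
exact: IH.
Qed.

(** An uncovered end adherent to the union lies at each level in a component
    [C]. Choose the level so that it contains the trace on the union of a good
    set [F0]; then the part of [F0] inside [C] misses the union, hence does not
    separate the end from the vertices which the level adds to [C]. *)
Lemma union_cover : partial_cover Hlim Alim.
Proof.
split.
- exact: union_insep.
- by move=> p [n _ np]; exact: (pc_ray (level_cover n) np).
- by move=> p [n _ np]; exact: (pc_fin (level_cover n) np).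
- by move=> p [n _ np] z pz; exists n => //; exact: (pc_mem (level_cover n) np).
- by move=> p [n _ np]; exact: (pc_good (level_cover n) np).
move=> e eG adh; apply: contrapT => eAA.
have eA n : ~ covered (A_ n) e.
  by move=> eA; apply: eAA; apply: covered_sub eA => p np; exists n.
have [F0 finF0 gF0] := good_ex eG.
have [n F0n] := union_finite finF0.
have lc := extend_local (level_cover n) eG (eA n).
have [finN eN] := uncovered_boundary (level_cover n) eG (eA n).
set C := region e (H_ n) in lc finN eN.
pose F := boundary C `|` (F0 `&` C).
have finF : finite_set F.
  by rewrite finite_setU; split=> //; exact: finite_setIl.
have eFC : region e F `<=` C.
  by rewrite -eN; apply: region_shrink => // z /region_notin + Nz; apply; left.
have gF : good e F.
  apply: good_sub gF0 => //; apply: region_shrink => // z ez F0z.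
  by apply: (region_notin ez); right; split=> //; exact: eFC.
have CF z : C z -> Hlim z -> ~ F z.
  move=> Cz Hlz [[]//|[F0z _]]; apply: (region_notin Cz); exact: F0n.
have [h [eh Hlh]] := adh F finF.
apply: (eA n.+1); apply: (@covered_sub (g C).2).
  by move=> p gp; right; exists e.
apply: (lc_absorb lc eG eN finF) => //; first by move=> z; left.
  by move=> z [Nz|[_ Cz]]; [left|right].
move=> z gz; have Cz := lc_sub lc gz.
have Hlz : Hlim z by exists n.+1 => //; right; exists e.
apply: (region_linked eh); apply: (linked_trace union_insep finF) => //.
- exact: region_notin eh.
- exact: CF.
apply: linked_sub (region_connected eG (eFC _ eh) Cz) => y Cy.
by split=> // -[Fy Hly]; exact: CF Fy.
Qed.

Lemma union_covers e : ray G e -> covered Alim e.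
Proof.
move=> eG; apply: contrapT => eAA.
have [finN eN] := uncovered_boundary union_cover eG eAA.
have [n Nn] := union_finite finN.
have eA : ~ covered (A_ n) e.
  by move=> eA; apply: eAA; apply: covered_sub eA => p np; exists n.
have lc := extend_local (level_cover n) eG eA.
have [z gz] := lc_ex lc.
have : region e Hlim z.
  rewrite -eN; apply: region_shrink (lc_sub lc gz) => // y /region_notin nHy Ny.
  by apply: nHy; apply: Nn; split=> //; exact: boundary_region Ny.
by move/region_notin; apply; exists n.+1 => //; right; exists e.
Qed.

(** Pairs created inside other components, or at other levels, are excluded by
    the fact that an end is uncovered when its component is treated. *)
Lemma union_locfin p : Alim p ->
  finite_set [set p' | Alim p' /\ region p'.1 p.2 = region p.1 p.2].
Proof.
move=> [n0 _ /level_born[n [e [_ eG eA gp]]]].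
have lc := extend_local (level_cover n) eG eA.
have [finN eN] := uncovered_boundary (level_cover n) eG eA.
set C := region e (H_ n) in lc finN eN gp.
have pG := lc_ray lc gp.
have pC : region p.1 p.2 `<=` C.
  rewrite -(lc_in lc gp); apply: region_shrink => // z /region_notin + Nz.
  by apply; exact: (lc_bnd lc gp Nz).
have An1p : A_ n.+1 p by right; exists e.
apply: sub_finite_set (lc_locfin lc gp) => p' [[n0' _ np'] pp']; split=> //.
have [m [e' [_ e'G e'A gp']]] := level_born np'.
have lc' := extend_local (level_cover m) e'G e'A.
have p'G := lc_ray lc' gp'.
have Am1p' : A_ m.+1 p' by right; exists e'.
have [m1 pm1] := region_finite p'G (lc_fin lc gp).
have [finN' eN'] := uncovered_boundary (level_cover m) e'G e'A.
have [m2 pm2] := region_finite p'G finN'.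
rewrite (lc_in lc' gp') in pm2.
have [m3 pm3] := region_finite p'G (lc_fin lc' gp').
pose k := maxn m1 (maxn m2 m3).
have kp : region p.1 p.2 (p'.1 k) by rewrite -pp'; apply: pm1; exact: leq_maxl.
have ke' : region e' (H_ m) (p'.1 k).
  by apply: pm2; rewrite leq_max leq_maxl orbT.
have kp' : region p'.1 p'.2 (p'.1 k).
  by apply: pm3; rewrite !leq_max leqnn !orbT.
have [nm|mn|mn] := ltngtP n m.
- case: e'A; apply: (covered_component _ pG _ e'G ke' kp).
    by have [_] := level_mono nm; exact.
  apply: subset_trans (pc_mem (level_cover n.+1) An1p) _.
  by have [] := level_mono nm.
- case: eA; apply: (covered_component _ p'G _ eG (pC _ kp) kp').
    by have [_] := level_mono mn; exact.
  apply: subset_trans (pc_mem (level_cover m.+1) Am1p') _.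
  by have [] := level_mono mn.
- move: gp' ke'; rewrite -mn => gp' ke'.
  by rewrite /C (region_eq eG e'G (pC _ kp) ke').
Qed.

End levels.

Lemma locally_finite_cover : exists A : set ((nat -> T) * set T),
  [/\ forall p, A p -> [/\ ray G p.1, finite_set p.2 & good p.1 p.2],
      forall e, ray G e -> covered A e &
      forall p, A p ->
        finite_set [set p' | A p' /\ region p'.1 p.2 = region p.1 p.2]].
Proof.
have /choice[g gP] : forall C, exists BA : set T * set ((nat -> T) * set T),
    forall e, finite_set (boundary C) -> ray G e -> region e (boundary C) = C ->
    local_cover C BA.1 BA.2.
  move=> C; have [[e [finN eG eC]]|nC] := pselect (exists e,
      [/\ finite_set (boundary C), ray G e & region e (boundary C) = C]).
    by have [B [A lc]] := local_cover_ex finN eG eC; exists (B, A).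
  by exists (set0, set0) => e finN eG eC; case: nC; exists e.
exists (\bigcup_n (level g n).2); split.
- move=> p [n _ np]; split.
  + exact: (pc_ray (level_cover gP n) np).
  + exact: (pc_fin (level_cover gP n) np).
  + exact: (pc_good (level_cover gP n) np).
- exact: union_covers.
- exact: union_locfin.
Qed.

End ends_of_a_graph.

(** * Ends and their topology *)

Section topology.
Context {T : choiceType} (G : graph T).
Implicit Types (x y z : end_space G) (r s : nat -> T) (F : set T).

Lemma end_ray x r : val x r -> ray G r.
Proof. by case: x => e /= /set_mem[s sG ->] []. Qed.

Lemma end_rep x : exists r, val x r.
Proof.
case: x => e /= /set_mem[r rG ->]; exists r.
by split=> //; exact: ray_equiv_refl.
Qed.

Lemma end_equiv x r s : val x r -> val x s <-> ray G s /\ ray_equiv G r s.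
Proof.
case: x => e /= /set_mem[t tG ->] [rG tr]; split=> -[sG].
  by move=> ts; split=> //; exact: ray_equiv_trans (ray_equiv_sym tr) ts.
by move=> rs; split=> //; exact: ray_equiv_trans tr rs.
Qed.

Lemma end_eq x y r : val x r -> val y r -> x = y.
Proof.
move=> xr yr; apply: val_inj; apply/seteqP; split=> s.
  by move/(end_equiv s xr)/(end_equiv s yr).
by move/(end_equiv s yr)/(end_equiv s xr).
Qed.

Lemma ray_end r : ray G r -> exists x, val x r.
Proof.
move=> rG; have eG : [set s | ray G s /\ ray_equiv G r s] \in ends G.
  by apply/mem_set; exists r.
exists (exist (fun e => e \in ends G) _ eG).
by split=> //; exact: ray_equiv_refl.
Qed.

Lemma region_vertices r F : ray G r ->
  region G r F = region G r (F `&` vertices G).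
Proof.
move=> rG; apply/seteqP; split; apply: region_shrink => // z.
  by move=> /region_notin nF [].
move=> rz Fz; apply: (region_notin rz); split=> //.
have [m _] := rz; case=> [_|u v _ uv _]; first by case: rG.
by have [uvG _] := edges_pairs uv; apply: uvG; right.
Qed.

Lemma component_linked F C a b : component (graph_minus G F) C ->
  vertices C a -> vertices C b -> linked G (~` F) a b.
Proof.
move=> [[CV CE] [_ conn] _] Ca Cb.
have CF u : vertices C u -> (~` F) u by move=> /CV[].
have : vertices C a -> vertices C b /\ linked G (~` F) a b.
  elim: (conn a b Ca Cb) => [u v uv Cu|u Cu|u v w _ IH1 _ IH2 Cu].
  - have [uvC _] := edges_pairs uv; have Cv : vertices C v by apply: uvC; right.
    split=> //; apply: linked_edge; [exact: CF|exact: CF|].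
    by have [] := CE _ uv.
  - by split=> //; exact/linked0/CF.
  - have [Cv uv] := IH1 Cu; have [Cw vw] := IH2 Cv.
    by split=> //; exact: linked_trans uv vw.
by case.
Qed.

(** An edge leaving [C] would span a connected subgraph meeting [C]. *)
Lemma linked_component F C a b : component (graph_minus G F) C ->
  vertices C a -> linked G (~` F) a b -> vertices C b.
Proof.
move=> hC Ca; elim=> // u v au Cu uv nFv.
have nFu := linked_r au.
have [uvG uv2] := edges_pairs uv.
have pairs : [set [set u; v]] `<=`
    [set e | e `<=` [set u; v] /\ (e #= `I_2)%card].
  by move=> e ->; split.
pose D := Graph pairs.
have DG : subgraph D (graph_minus G F).
  have sub : [set u; v] `<=` vertices G `\` F.
    by move=> w uvw; split; [exact: uvG|case: uvw => ->].
  by split=> //= e ->; split.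
have cD : connected_graph D.
  have uvD : adj D u v by [].
  split; first by exists u; left.
  by move=> w w' [->|->] [->|->]; (exact: Relation_Operators.rt_refl ||
    (apply: Relation_Operators.rt_step; rewrite /adj //=; exact: setUC)).
have [|C' hC' [DC' _]] := component_exists DG cD (x := u); first by left.
rewrite (component_unique hC hC' Cu (DC' u (or_introl erefl))).
by apply: DC'; right.
Qed.

Lemma component_region F C r m : ray G r -> component (graph_minus G F) C ->
  ray C (tail m r) -> vertices C = region G r F.
Proof.
move=> rG hC [rC _ _].
have Cr k : (m <= k)%N -> vertices C (r k).
  by move=> /subnKC <-; exact: rC.
have CF u : vertices C u -> ~ F u by case: hC => [[CV _] _ _] /CV[].
apply/seteqP; split=> y.
  move=> Cy; exists m => [k /Cr/CF//|].
  by apply: component_linked hC _ Cy; exact: Cr.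
move=> [n nF ny].
apply: (linked_component hC (Cr _ (leq_maxl m n))).
apply: linked_trans ny; apply: linked_sym.
exact: (ray_linked (X := ~` F) rG nF (leq_maxr m n)).
Qed.

Lemma end_component_region x r F : finite_set F -> F `<=` vertices G ->
  val x r -> vertices (end_component x F) = region G r F.
Proof.
move=> finF FG xr; have [hC /(_ r xr)[n rn]] := end_componentP x finF FG.
exact: component_region (end_ray xr) hC rn.
Qed.

Lemma ends_inP x y r s F : finite_set F -> F `<=` vertices G ->
  val x r -> val y s -> ends_in x F y <-> region G s F = region G r F.
Proof.
move=> finF FG xr ys; split=> [[t yt tC]|sr].
  have [hC _] := end_componentP x finF FG.
  rewrite -(end_component_region finF FG xr).
  rewrite -(end_component_region finF FG ys) (end_component_region finF FG yt).
  by rewrite (@component_region F _ t 0 (end_ray yt) hC tC).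
have [hD /(_ s ys)[n sn]] := end_componentP y finF FG.
have [hC _] := end_componentP x finF FG.
have [a sa] := region_ex (end_ray ys) finF.
have CD : end_component x F = end_component y F.
  apply: (component_unique hC hD (x := a)).
    by rewrite (end_component_region finF FG xr) -sr.
  by rewrite (end_component_region finF FG ys).
exists (tail n s); last by rewrite CD.
apply/(end_equiv _ ys); split; first exact/ray_tail/end_ray/ys.
move=> F' finF' F'G.
have [C [hC' [m sm] _]] := ray_equiv_refl (end_ray ys) finF' F'G.
exists C; split=> //; first by exists m.
by exists m; rewrite tail_tail addnC -tail_tail; exact: ray_tail.
Qed.

Lemma ends_in_refl x F : finite_set F -> F `<=` vertices G -> ends_in x F x.
Proof.
by move=> finF FG; have [r xr] := end_rep x; apply/(ends_inP finF FG xr xr).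
Qed.

Lemma ends_in_open x F : finite_set F -> F `<=` vertices G ->
  open (ends_in x F).
Proof.
move=> finF FG; rewrite open_endsE => y xy; exists F; split=> // z yz.
have [[r xr] [[s ys] [t zt]]] := (end_rep x, (end_rep y, end_rep z)).
apply/(ends_inP finF FG xr zt).
by rewrite (ends_inP finF FG ys zt).1// (ends_inP finF FG xr ys).1.
Qed.

(** Ends that no finite set separates are equal. *)
Lemma end_space_accessible : accessible_space (end_space G).
Proof.
move=> x y /eqP xy; have [[r xr] [s ys]] := (end_rep x, end_rep y).
have [F [finF FG nF]] : exists F, [/\ finite_set F, F `<=` vertices G &
    ~ ends_in x F y].
  apply: contrapT => noF; apply: xy; apply: (end_eq _ ys).
  apply/(end_equiv s xr); split; first exact: end_ray ys.
  move=> F finF FG.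
  have sr : region G s F = region G r F.
    apply/(ends_inP finF FG xr ys); apply: contrapT => nF.
    by apply: noF; exists F.
  have [hC /(_ r xr)[m rm]] := end_componentP x finF FG.
  have [hD /(_ s ys)[n sn]] := end_componentP y finF FG.
  exists (end_component x F); split=> //; first by exists m.
  exists n; have [a sa] := region_ex (end_ray ys) finF.
  rewrite (component_unique hC hD (x := a)) //.
    by rewrite (end_component_region finF FG xr) -sr.
  by rewrite (end_component_region finF FG ys).
exists (ends_in x F); split; first exact: ends_in_open.
- by apply/mem_set/ends_in_refl.
- exact/mem_set.
Qed.

Lemma end_space_D_space : D_space (end_space G).
Proof.
move=> W Wnbhs.
pose U r s := forall x y, val x r -> val y s -> W x y.
have [|A [AP Acov Afin]] := @locally_finite_cover T G U.
  move=> r rG; have [x xr] := ray_end rG.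
  have [+ Wx] := Wnbhs x; rewrite open_endsE => /(_ x Wx)[F [finF FG FW]].
  exists F => // s sG sr x' y x'r ys; rewrite (end_eq x'r xr); apply: FW.
  by apply/(ends_inP finF FG xr ys).
pose V (p : (nat -> T) * set T) := p.2 `&` vertices G.
have finV p : A p -> finite_set (V p) by move=> /AP[_ ? _]; exact: finite_setIl.
have VG p : V p `<=` vertices G by move=> z [].
pose D := [set x : end_space G | exists2 p, A p & val x p.1].
have Dcov y : exists p x, [/\ A p, val x p.1, ends_in x (V p) y & W x y].
  have [s ys] := end_rep y; have sG := end_ray ys.
  have [p Ap sp] := Acov s sG; have [pG finp gp] := AP p Ap.
  have [x xp] := ray_end pG; exists p, x; split=> //; last exact: gp xp ys.
  apply/(ends_inP (finV p Ap) (VG p) xp ys).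
  by rewrite -!region_vertices.
have Dfin y : exists O, [/\ open O, O y & finite_set (O `&` D)].
  have [p [x [Ap xp xy _]]] := Dcov y.
  exists (ends_in x (V p)); split=> //.
    exact: ends_in_open (finV p Ap) (VG p).
  have /choice[c cP] : forall q, exists z : end_space G, ray G q -> val z q.
    move=> q; have [/ray_end[z zq]|nq] := pselect (ray G q); first by exists z.
    by exists x => /nq.
  apply: sub_finite_set (finite_image (fun q => c q.1) (Afin p Ap)).
  move=> z [xz [q Aq zq]]; have qG := end_ray zq.
  exists q; last exact: end_eq (cP _ qG) zq.
  split=> //; rewrite (region_vertices _ qG) (region_vertices _ (end_ray xp)).
  exact/(ends_inP (finV p Ap) (VG p) xp zq).
have Dnbhs y : exists2 O, nbhs y O & O `&` D `<=` [set y].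
  have [O [oO Oy finOD]] := Dfin y.
  exists (O `\` ((O `&` D) `\ y)); last first.
    by move=> z [[Oz nz] Dz]; apply: contrapT => zy; apply: nz; split.
  apply: open_nbhs_nbhs; split; last by split=> // -[_]; exact.
  rewrite setDE; apply: openI => //; apply: closed_openC.
  apply: (accessible_finite_set_closed.1 end_space_accessible).
  exact: finite_setD.
exists D; split.
- move=> y Dy; have [O Oy OD] := Dnbhs y.
  by have [z [Dz Oz]] := Dy O Oy; rewrite -(OD z).
- move=> y Dy; split; first exact/mem_set.
  have [O Oy OD] := Dnbhs y; exists O => //; apply/seteqP; split=> // z ->.
  by split=> //; exact: nbhs_singleton.
- apply/seteqP; split=> // y _; have [p [x [Ap xp _ Wxy]]] := Dcov y.
  by exists x => //; exists p.
Qed.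

End topology.

Theorem corollary3p4 (T : Type) (G : graph T) : D_space (end_space G).
Proof. exact: (@end_space_D_space {classic T} G). Qed.
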